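(* Let $k\ge 3$. Let $P$ be either of the following two-row standard Young tableaux: (a) first row $1,2,\dots,k$ and second row $k+1,k+2,\dots,2k$; (b) first row $1,2,\dots,k,k+1$ and second row $k+2,k+3,\dots,2k+1$. Then all elements of the Kazhdan--Lusztig right cell $\mathcal{C}_R(P)$ are non-smooth. In fact, every element of $\mathcal{C}_R(P)$ contains $(k+1,k+2,k-1,k)$ as a subsequence in case (a), and $(k+2,k+3,k,k+1)$ as a subsequence in case (b).
   Context: Permutations $w\in S_n$ are written in one-line notation $w=(w_1,\dots,w_n)$; a subsequence of $w$ is a list of entries of $w$ in the order in which they occur (not necessarily adjacent). $P(w)$ denotes the Robinson--Schensted (row) insertion tableau of $w$. Two elements of $S_n$ are in the same Kazhdan--Lusztig right cell if and only if they have the same insertion tableau; for a standard Young tableau $P$ with $n$ boxes, $\mathcal{C}_R(P)=\{w\in S_n: P(w)=P\}$ is the corresponding right cell. An element $w\in S_n$ contains the pattern $3412$ (resp. $4231$) if there are indices $a<b<c<d$ with $w_c<w_d<w_a<w_b$ (resp. $w_d<w_b<w_c<w_a$). The element $w$ is smooth if the Schubert variety $X_w=\overline{BwB/B}$ of type $A$ is smooth; equivalently, if $w$ contains neither $3412$ nor $4231$. *)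

(* Defs.v *)
From HB Require Import structures.
From mathcomp Require Import all_boot all_order all_fingroup all_algebra.
From mathcomp Require Import mpoly.

Set Implicit Arguments.
Unset Strict Implicit.
Unset Printing Implicit Defensive.

Import GRing.Theory.
Local Open Scope ring_scope.

(** * Robinson-Schensted insertion *)

(* A permutation of {1, ..., n} is an element of 'S_n, which acts on
   {0, ..., n-1}; its one-line notation is shifted to have entries 1, ..., n. *)
Definition one_line (n : nat) (w : 'S_n) : seq nat :=
  [seq (nat_of_ord (w i)).+1 | i <- enum 'I_n].

(* Insertion of x in a row: x replaces the leftmost entry larger than x, which
   is returned as bumped, or is put at the end if there is no such entry. *)
Fixpoint row_insert (x : nat) (r : seq nat) : seq nat * option nat :=
  match r with
  | [::] => ([:: x], None)
  | y :: r' =>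
      if (x < y)%N then (x :: r', Some y)
      else let: (r'', b) := row_insert x r' in (y :: r'', b)
  end.

(* A tableau is the list of its rows, from the first one. *)
Fixpoint tableau_insert (t : seq (seq nat)) (x : nat) : seq (seq nat) :=
  match t with
  | [::] => [:: [:: x]]
  | r :: t' =>
      match row_insert x r with
      | (r', None) => r' :: t'
      | (r', Some y) => r' :: tableau_insert t' y
      end
  end.

Definition insertion_tableau (n : nat) (w : 'S_n) : seq (seq nat) :=
  foldl tableau_insert [::] (one_line w).

(* The right cell C_R(P). *)
Definition right_cell (n : nat) (P : seq (seq nat)) : {set 'S_n} :=
  [set w | insertion_tableau w == P].

(** * Smooth affine varieties *)

(* Points of the affine N-space are row vectors; f.@[v 0] is the value of the
   polynomial f at the point v. *)

Definition vanishes_on (F : closedFieldType) (N : nat)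
    (S : 'rV[F]_N -> Prop) (f : {mpoly F[N]}) : Prop :=
  forall v, S v -> f.@[v 0] = 0.

Definition zariski_closure (F : closedFieldType) (N : nat)
    (S : 'rV[F]_N -> Prop) : 'rV[F]_N -> Prop :=
  fun v => forall f, vanishes_on S f -> f.@[v 0] = 0.

(* The Zariski tangent space of Y at p, as a subset of F^N. *)
Definition is_tangent (F : closedFieldType) (N : nat)
    (Y : 'rV[F]_N -> Prop) (p v : 'rV[F]_N) : Prop :=
  forall f, vanishes_on Y f -> \sum_(i < N) (f^`M(i)).@[p 0] * v 0 i = 0.

Definition tangent_dim (F : closedFieldType) (N : nat)
    (Y : 'rV[F]_N -> Prop) (p : 'rV[F]_N) (d : nat) : Prop :=
  exists V : {vspace 'rV[F]_N},
    (forall v, v \in V <-> is_tangent Y p v) /\ \dim V = d.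

(* The restrictions of f 0, ..., f (d-1) to Y are algebraically independent
   elements of the coordinate ring of Y. *)
Definition alg_independent_on (F : closedFieldType) (N d : nat)
    (Y : 'rV[F]_N -> Prop) (f : 'I_d -> {mpoly F[N]}) : Prop :=
  forall q : {mpoly F[d]},
    (forall v, Y v -> q.@[fun i => (f i).@[v 0]] = 0) -> q = 0.

(* The dimension of an irreducible Y: the transcendence degree over F of its
   field of functions, that is, the maximal number of algebraically independent
   elements of its coordinate ring. *)
Definition variety_dim (F : closedFieldType) (N : nat)
    (Y : 'rV[F]_N -> Prop) (d : nat) : Prop :=
  (exists f : 'I_d -> {mpoly F[N]}, alg_independent_on Y f) /\
  (forall (e : nat) (f : 'I_e -> {mpoly F[N]}),
     alg_independent_on Y f -> (e <= d)%N).

(* For Y closed, and irreducible or empty. *)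
Definition smooth_variety (F : closedFieldType) (N : nat)
    (Y : 'rV[F]_N -> Prop) : Prop :=
  forall p, Y p -> exists d, variety_dim Y d /\ tangent_dim Y p d.

(** * Schubert varieties of type A *)

(* B *)
Definition borel (F : closedFieldType) (n : nat) (b : 'M[F]_n) : Prop :=
  b \in unitmx /\ is_trig_mx b^T.

(* U^- *)
Definition lower_unipotent (F : closedFieldType) (n : nat) (u : 'M[F]_n) :
    Prop :=
  is_trig_mx u /\ forall i, u i i = 1.

(* BwB, where w is the matrix sending the basis column e_j to e_(w j); it is
   the transpose of perm_mx w. *)
Definition bruhat_cell (F : closedFieldType) (n : nat) (w : 'S_n)
    (a : 'M[F]_n) : Prop :=
  exists b1 b2 : 'M[F]_n,
    [/\ borel b1, borel b2 & a = b1 *m (perm_mx w)^T *m b2].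

(* The flag variety G/B, G = GL_n(F), is covered by the open subsets g U^- B/B
   (g in G), and u |-> g u B/B is an isomorphism from the affine space U^- to
   g U^- B/B.  In this chart, the intersection of g U^- B/B with the Schubert
   cell BwB/B is the set of all u in U^- such that g u is in BwB, and, since
   g U^- B/B is open, its intersection with X_w, the closure of BwB/B, is the
   closure of that set.  Here U^- is seen as a closed (affine) subspace of the
   space of all n x n matrices, whose coordinates are given by mxvec. *)
Definition cell_chart (F : closedFieldType) (n : nat) (w : 'S_n)
    (g : 'M[F]_n) : 'rV[F]_(n * n) -> Prop :=
  fun v => lower_unipotent (vec_mx v) /\ bruhat_cell w (g *m vec_mx v).

Definition schubert_chart (F : closedFieldType) (n : nat) (w : 'S_n)
    (g : 'M[F]_n) : 'rV[F]_(n * n) -> Prop :=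
  zariski_closure (cell_chart w g).

(* w is smooth: X_w is smooth, that is, its intersection with each of the above
   charts is. These intersections are open in the irreducible variety X_w,
   hence irreducible or empty. *)
Definition smooth_perm (F : closedFieldType) (n : nat) (w : 'S_n) : Prop :=
  forall g : 'M[F]_n, g \in unitmx -> smooth_variety (schubert_chart w g).
Arguments smooth_perm F {n} w.

(* Main.v *)
Require Import Defs.
From HB Require Import structures.
From mathcomp Require Import all_boot all_order all_fingroup all_algebra.
From mathcomp Require Import mpoly zify ring.

(** Both claims follow from the position of four consecutive values
    p - 1, p, p + 1, p + 2 in w, where p is the length of the first row of P.

    Combinatorics. If the insertion tableau of w has rows 1, ..., p and
    p + 1, ..., p + q, then no small entry (<= p) is ever bumped, and each big
    entry is bumped exactly once, by a small entry. This forces w to be a shuffle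
    of the words 1 ... p and (p + 1) ... (p + q), in which every suffix contains
    at least as many small entries as big ones ([shuffle_of_insertion]). The
    suffix that starts at p + 2 has q - 1 >= 2 big entries, so it contains
    p - 1 and p: thus p + 1, p + 2, p - 1, p occur in this order in w.

    Geometry. Let w have the pattern 3412 at positions a < b < c < d with
    consecutive values m + 2, m + 3, m, m + 1, and let v be obtained from w by
    rearranging these values in the order m, m + 2, m + 1, m + 3. Since the
    values are consecutive, the intersection of BwB/B with the chart v U^- B/B
    is contained in an affine space 1 + L of matrices and, up to a change of
    coordinates, in a quadric cone of this space with vertex at the center
    u = 1 of the chart ([cell_equations]). It also contains enough explicit
    curves that converge to u = 1 ([cell_pt_in_cell]) for the tangent space of
    its closure at u = 1 to be L ([tangent_at_1]). At another point of the cell,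
    the differential of the equation of the cone is not zero on L, and the
    tangent space is a proper subspace of L. But all tangent spaces
    of a smooth variety have the same dimension ([smooth_tangent_incl]). *)

Set Implicit Arguments.
Unset Strict Implicit.
Unset Printing Implicit Defensive.

Import GRing.Theory.
Local Open Scope ring_scope.

(** * Triangular matrices and Bruhat cells *)

Lemma trig_mul (R : comNzRingType) n (A B : 'M[R]_n) :
  is_trig_mx A -> is_trig_mx B -> is_trig_mx (A *m B).
Proof.
move=> /is_trig_mxP tA /is_trig_mxP tB; apply/is_trig_mxP => i j ij.
rewrite mxE big1 // => l _; have [il|li] := ltnP i l; first by rewrite tA ?mul0r.
by rewrite tB ?mulr0 // (leq_ltn_trans li).
Qed.

Lemma borel_mul (F : closedFieldType) n (A B : 'M[F]_n) :
  borel A -> borel B -> borel (A *m B).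
Proof.
case=> uA tA [uB tB]; split; first by rewrite unitmx_mul uA.
by rewrite trmx_mul trig_mul.
Qed.

Lemma trig_unit_diag (F : fieldType) n (A : 'M[F]_n) i :
  is_trig_mx A -> A \in unitmx -> A i i != 0.
Proof.
move=> tA; rewrite unitmxE det_trig // unitfE => /prodf_neq0; exact.
Qed.

(** By induction on the column index j: if the entries of A^-1 left of column j
    vanish below the diagonal, then for j < i the (i, j) entry of A^-1 * A = 1
    reduces to the product of the (i, j) entry of A^-1 and the (j, j) entry
    of A. *)
Lemma borel_inv (F : closedFieldType) n (A : 'M[F]_n) :
  borel A -> borel (invmx A).
Proof.
case=> uA tA; split; first by rewrite unitmx_inv.
apply/is_trig_mxP => j i; rewrite mxE.
have [k] := ubnP (nat_of_ord j); elim: k j => // k IH j jk ji.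
have Ajj : A j j != 0.
  by have := trig_unit_diag j tA; rewrite unitmx_tr mxE; apply.
have := congr1 (fun M : 'M_n => M i j) (mulVmx uA).
rewrite !mxE (bigD1 j) //= big1 ?addr0 => [|l lj].
  by rewrite -val_eqE (gtn_eqF ji) => /eqP; rewrite mulf_eq0 (negPf Ajj) orbF => /eqP.
have [jl|l_le] := ltnP j l.
  by have := is_trig_mxP tA _ _ jl; rewrite mxE => ->; rewrite mulr0.
have lt_lj : (l < j)%N by rewrite ltn_neqAle lj.
by rewrite IH ?mul0r //; [exact: leq_trans lt_lj _ | exact: ltn_trans ji].
Qed.

Lemma lower_unipotent_mul (F : closedFieldType) n (A B : 'M[F]_n) :
  lower_unipotent A -> lower_unipotent B -> lower_unipotent (A *m B).
Proof.
case=> tA dA [tB dB]; split=> [|i]; first exact: trig_mul.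
rewrite mxE (bigD1 i) //= dA dB mulr1 big1 ?addr0 // => l li.
have [il|l_le] := ltnP i l; first by rewrite (is_trig_mxP tA) ?mul0r.
by rewrite (is_trig_mxP tB) ?mulr0 // ltn_neqAle li.
Qed.

Lemma lower_unipotent_unit (F : closedFieldType) n (A : 'M[F]_n) :
  lower_unipotent A -> A \in unitmx.
Proof. by case=> tA dA; rewrite unitmxE det_trig // big1 ?unitr1. Qed.

Lemma bruhat_cell_mull (F : closedFieldType) n (w : 'S_n) (A B : 'M[F]_n) :
  borel A -> bruhat_cell w B -> bruhat_cell w (A *m B).
Proof.
move=> bA [b1 [b2 [bb1 bb2 ->]]]; exists (A *m b1), b2; split=> //.
  exact: borel_mul.
by rewrite !mulmxA.
Qed.

Lemma bruhat_cell_mulr (F : closedFieldType) n (w : 'S_n) (A B : 'M[F]_n) :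
  borel B -> bruhat_cell w A -> bruhat_cell w (A *m B).
Proof.
move=> bB [b1 [b2 [bb1 bb2 ->]]]; exists b1, (b2 *m B); split=> //.
  exact: borel_mul.
by rewrite !mulmxA.
Qed.

Lemma tr_perm_mxE (F : nzRingType) n (v : 'S_n) (A : 'M[F]_n) i j :
  ((perm_mx v)^T *m A) (v i) j = A i j.
Proof. by rewrite tr_perm_mx -row_permE mxE permK. Qed.

(** Conjugating by the matrix of v moves the (i, j) entry to (v i, v j), so it
    makes upper triangular the matrices supported where v i <= v j. *)
Lemma perm_mx_conj (F : closedFieldType) n (v : 'S_n) (A : 'M[F]_n) :
    A \in unitmx -> (forall i j, (v j < v i)%N -> A i j = 0) ->
  exists2 b, borel b & (perm_mx v)^T *m A = b *m (perm_mx v)^T.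
Proof.
move=> uA A0; exists ((perm_mx v)^T *m A *m perm_mx v); last first.
  by rewrite -mulmxA tr_perm_mx -perm_mxM mulgV perm_mx1 mulmx1.
split; first by rewrite !unitmx_mul unitmx_tr unitmx_perm uA.
apply/is_trig_mxP => i j ij.
rewrite tr_perm_mx -row_permE -[in perm_mx v](invgK v) -col_permE !mxE.
by apply: A0; rewrite !permKV.
Qed.

(** The k by k matrices act on the coordinates f 0, ..., f (k-1) of an n-space and
    fix the other ones; [frame] is the matrix of the inclusion of these
    coordinates. *)
Section Embed.
Variables (R : comNzRingType) (k n : nat) (f : 'I_k -> 'I_n).
Hypothesis f_inj : injective f.

Definition frame : 'M[R]_(n, k) := colsub f 1%:M.

Lemma tr_frame_mul p (X : 'M[R]_(n, p)) i j : (frame^T *m X) i j = X (f i) j.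
Proof.
have -> : frame^T = rowsub f 1%:M by apply/matrixP => r s; rewrite !mxE eq_sym.
by rewrite mul_rowsub_mx mul1mx mxE.
Qed.

Lemma frameK : frame^T *m frame = 1%:M.
Proof.
rewrite mulmx_colsub mulmx1; apply/matrixP => i j.
by rewrite !mxE (inj_eq f_inj) eq_sym.
Qed.

Definition embed (A : 'M[R]_k) : 'M[R]_n :=
  1%:M + frame *m (A - 1%:M) *m frame^T.

Lemma embedM A B : embed A *m embed B = embed (A *m B).
Proof.
pose a : 'M[R]_k := A - 1%:M; pose b : 'M[R]_k := B - 1%:M.
have ab : A *m B - 1%:M = b + (a + a *m b).
  rewrite -[A](subrK 1%:M) -[B](subrK 1%:M) -/a -/b.
  by rewrite mulmxDl mul1mx mulmxDr mulmx1 addrA addrK addrC [_ + a]addrC.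
rewrite /embed ab -/a -/b mulmxDl mul1mx mulmxDr mulmx1 -addrA; congr (_ + _).
move: a b {ab} => a b.
rewrite !mulmxDr !mulmxDl; congr (_ + (_ + _)).
rewrite !mulmxA -(mulmxA (frame *m a) frame^T frame).
by rewrite frameK mulmx1.
Qed.

Lemma frame_mulE (B : 'M[R]_k) i j : (frame *m B *m frame^T) (f i) (f j) = B i j.
Proof.
have : frame^T *m (frame *m B *m frame^T) *m frame = B.
  by rewrite !mulmxA frameK mul1mx -mulmxA frameK mulmx1.
move/matrixP/(_ i j) <-; rewrite mulmx_colsub mulmx1 [RHS]mxE.
by rewrite tr_frame_mul.
Qed.

Lemma embedE A i j : embed A (f i) (f j) = A i j.
Proof.
by rewrite mxE frame_mulE !mxE (inj_eq f_inj) addrC subrK.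
Qed.

Lemma frame_mul0 (B : 'M[R]_k) r s :
  (forall i j, r = f i -> s = f j -> False) -> (frame *m B *m frame^T) r s = 0.
Proof.
move=> rs; rewrite mxE big1 // => j _; rewrite ![in X in _ * X]mxE.
have [sj|] := eqVneq s (f j); last by rewrite mulr0.
rewrite [X in X * _]mxE big1 ?mul0r // => i _; rewrite !mxE.
by have [ri|] := eqVneq r (f i); [case: (rs i j) | rewrite mul0r].
Qed.

Lemma embed_out A r s :
  (forall i j, r = f i -> s = f j -> False) -> embed A r s = (r == s)%:R.
Proof. by move=> rs; rewrite mxE frame_mul0 // mxE addr0. Qed.

End Embed.

(** * Curves and tangent spaces *)

Section Curves.
Variables (F : closedFieldType) (N : nat).
Implicit Types (P : 'I_N -> {poly F}) (f : {mpoly F[N]}).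

(** The restriction of f to the curve t |-> (P_1(t), ..., P_N(t)). *)
Definition along P f : {poly F} := mmap (@polyC F) P f.

Lemma alongE P f t : (along P f).[t] = f.@[fun i => (P i).[t]].
Proof.
rewrite /along /mmap horner_sum mevalE; apply: eq_bigr => m _.
rewrite hornerM hornerC horner_prod; congr (_ * _).
by apply: eq_bigr => i _; rewrite horner_exp.
Qed.

Lemma alongD P f g : along P (f + g) = along P f + along P g.
Proof. exact: mmapD. Qed.

Lemma alongB P f g : along P (f - g) = along P f - along P g.
Proof. exact: mmapB. Qed.

Lemma alongM P f g : along P (f * g) = along P f * along P g.
Proof. exact: rmorphM. Qed.

Lemma alongC P c : along P c%:MP = c%:P.
Proof. exact: mmapC. Qed.

Lemma alongX P i : along P 'X_i = P i.
Proof. by rewrite /along mmapX mmap1U. Qed.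

(** The chain rule. Both sides are derivations in f, so it suffices to compare
    them on the variables. *)
Lemma along_deriv P f :
  (along P f)^`() = \sum_i along P f^`M(i) * (P i)^`().
Proof.
pose ok g := (along P g)^`() = \sum_i along P g^`M(i) * (P i)^`().
have okD g h : ok g -> ok h -> ok (g + h).
  rewrite /ok alongD derivD => -> ->; rewrite -big_split; apply: eq_bigr => i _.
  by rewrite mderivD alongD mulrDl.
have okM g h : ok g -> ok h -> ok (g * h).
  rewrite /ok alongM derivM => -> ->; rewrite mulr_suml mulr_sumr -big_split.
  apply: eq_bigr => i _ /=; rewrite mderivM alongD !alongM mulrDl.
  by rewrite mulrAC mulrA.
have okC c : ok c%:MP.
  rewrite /ok alongC derivC big1 // => i _.
  by rewrite mderivC -mpolyC0 alongC mul0r.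
have okX i : ok 'X_i.
  rewrite /ok alongX (bigD1 i) //= big1 ?addr0 => [|j ji].
    have -> : ('X_i : {mpoly F[N]})^`M(i) = 1%:MP.
      rewrite mderivX mnmE eqxx scale1r mpolyC1 -mpolyX0; congr 'X_[_].
      by apply/mnmP => j; rewrite mnmBE mnm0E subnn.
    by rewrite alongC mul1r.
  by rewrite mderivX mnmE eq_sym (negPf ji) scale0r -mpolyC0 alongC mul0r.
elim/mpolyind: f => [|c m f _ _ IH]; first by rewrite -mpolyC0; apply: okC.
apply: (okD) => //; rewrite -mul_mpolyC; apply: (okM) => //.
rewrite mpolyXE_id; elim/big_ind: _ => [||i _]; first by rewrite -mpolyC1; apply: okC.
  exact: okM.
elim: (m i) => [|k IHk]; first by rewrite expr0 -mpolyC1; apply: okC.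
by rewrite exprS; apply: okM.
Qed.

(** An algebraically closed field is infinite; more directly, if h were nonzero
    then h * 'X + 1 would have a root, at which it would take the value 1. *)
Lemma poly_vanish (h : {poly F}) : (forall t, t != 0 -> h.[t] = 0) -> h = 0.
Proof.
move=> h0; apply/eqP/negP => /negP nz_h.
have : size (h * 'X + 1%:P) != 1%N.
  rewrite -[h * 'X + _]cons_poly_def size_cons_poly nil_poly (negPf nz_h) /=.
  by rewrite eqSS size_poly_eq0.
case/closed_rootP => x; rewrite rootE !hornerE.
have [->|/h0 ->] := eqVneq x 0; rewrite ?mulr0 ?mul0r add0r; exact/negP/oner_neq0.
Qed.

(** A curve that is in S except perhaps at t = 0 has its value at 0 in the closure
    of S, and its velocity at 0 is tangent to this closure (next lemma). *)
Lemma curve_limit (S : 'rV[F]_N -> Prop) P :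
    (forall t, t != 0 -> S (\row_i (P i).[t])) ->
  forall f, vanishes_on S f -> along P f = 0.
Proof.
move=> SP f f0; apply: poly_vanish => t /SP/f0; rewrite alongE => <-.
by apply: meval_eq => i; rewrite mxE.
Qed.

Lemma curve_tangent (S : 'rV[F]_N -> Prop) P :
    (forall t, t != 0 -> S (\row_i (P i).[t])) ->
  forall f, vanishes_on S f ->
  \sum_i f^`M(i).@[fun j => (P j).[0]] * ((P i)^`()).[0] = 0.
Proof.
move=> SP f f0; have := along_deriv P f; rewrite (curve_limit SP f0) deriv0.
move/(congr1 (horner^~ 0)); rewrite horner0 horner_sum => /esym e.
by rewrite -[RHS]e; apply: eq_bigr => i _; rewrite hornerM alongE.
Qed.

(** Turns a tangent vector into equations: to differentiate f at p in the
    direction v, restrict f to the line through p directed by v. *)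
Lemma tangent_line (Y : 'rV[F]_N -> Prop) p v f : is_tangent Y p v ->
  vanishes_on Y f ->
  ((along (fun i => (p 0 i)%:P + v 0 i *: 'X) f)^`()).[0] = 0.
Proof.
move=> tv f0; rewrite along_deriv horner_sum -[RHS](tv f f0).
apply: eq_bigr => i _; rewrite hornerM alongE derivD derivC derivZ derivX.
rewrite add0r hornerZ hornerC mulr1.
by congr (_ * _); apply: meval_eq => j; rewrite hornerD hornerC hornerZ hornerX mulr0 addr0.
Qed.

Lemma vanishes_on_closure (S : 'rV[F]_N -> Prop) f :
  vanishes_on S f -> vanishes_on (zariski_closure S) f.
Proof. by move=> f0 v; apply. Qed.

Lemma sub_closure (S : 'rV[F]_N -> Prop) p : S p -> zariski_closure S p.
Proof. by move=> Sp f; apply. Qed.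

Lemma variety_dim_uniq (Y : 'rV[F]_N -> Prop) d1 d2 :
  variety_dim Y d1 -> variety_dim Y d2 -> d1 = d2.
Proof.
case=> [[f1 i1] m1] [[f2 i2] m2]; apply/eqP.
by rewrite eqn_leq (m2 _ _ i1) (m1 _ _ i2).
Qed.

(** All tangent spaces of a smooth variety have the same dimension, so an
    inclusion between two of them is an equality. *)
Lemma smooth_tangent_incl (Y : 'rV[F]_N -> Prop) p q : smooth_variety Y ->
    Y p -> Y q -> (forall v, is_tangent Y q v -> is_tangent Y p v) ->
  forall v, is_tangent Y p v -> is_tangent Y q v.
Proof.
move=> smY Yp Yq qp v.
have [d [dimY [Tp [Tp_def dim_p]]]] := smY p Yp.
have [d' [dimY' [Tq [Tq_def dim_q]]]] := smY q Yq.
have sTqp : (Tq <= Tp)%VS by apply/subvP => u /Tq_def/qp/Tp_def.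
have : (Tq == Tp)%VS.
  by rewrite eqEdim sTqp dim_p dim_q (variety_dim_uniq dimY dimY') leqnn.
by move/eqP=> eT /Tp_def; rewrite -eT => /Tq_def.
Qed.

End Curves.

Lemma sum_mxvec (F : nzRingType) n (a : 'I_(n * n) -> F) (A : 'M[F]_n) :
  \sum_k a k * mxvec A 0 k = \sum_i \sum_j a (mxvec_index i j) * A i j.
Proof.
rewrite pair_bigA (reindex _ (curry_mxvec_bij n n)) /=.
by apply: eq_bigr => -[i j] _ /=; rewrite mxvecE.
Qed.

(** * Non-smoothness from a 3412 pattern with consecutive values *)

(** With F the frame, this is tr (a^T F M F^T) = tr (F^T a^T F M). *)
Lemma sum_frame (R : comNzRingType) k n (f : 'I_k -> 'I_n) (a : 'M[R]_n)
    (M : 'M[R]_k) :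
  \sum_r \sum_s a r s * (frame R f *m M *m (frame R f)^T) r s
    = \sum_i \sum_j a (f i) (f j) * M i j.
Proof.
have trE m (A B : 'M[R]_m) : \sum_r \sum_s A r s * B r s = \tr (A^T *m B).
  rewrite exchange_big; apply: eq_bigr => s _; rewrite mxE.
  by apply: eq_bigr => r _; rewrite mxE.
rewrite trE !mulmxA mxtrace_mulC !mulmxA.
have -> : (frame R f)^T *m a^T *m frame R f = (mxsub f f a)^T.
  apply/matrixP => i j; rewrite mulmx_colsub mulmx1 mxE.
  by rewrite tr_frame_mul !mxE.
by rewrite -trE; apply: eq_bigr => i _; apply: eq_bigr => j _; rewrite !mxE.
Qed.

Lemma embed_eq0 (R : comNzRingType) k n (f : 'I_k -> 'I_n) (A : 'M[R]_k)
    (e : rel 'I_n) : injective f -> irreflexive e ->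
    (forall i j, e (f i) (f j) -> A i j = 0) ->
  forall r s, e r s -> embed f A r s = 0.
Proof.
move=> f_inj irr A0 r s ers.
have [i /eqP ri|nr] := pickP (fun i => r == f i); last first.
  rewrite embed_out => [|i j ri _]; last by move: (nr i); rewrite ri eqxx.
  by have [rs|//] := eqVneq r s; rewrite rs irr in ers.
have [j /eqP sj|ns] := pickP (fun j => s == f j); last first.
  rewrite embed_out => [|? j _ sj]; last by move: (ns j); rewrite sj eqxx.
  by have [rs|//] := eqVneq r s; rewrite rs irr in ers.
by rewrite ri sj embedE // A0 // -ri -sj.
Qed.

(** If C = u B vanishes at (i, l) when w l < v i, then it has zeros in its j-th
    column at all rows i with r <= v i, since w j < r. These zeros are a
    unitriangular system for the entries of B in the j-th column, at the rows l
    with r <= v l: by induction on the column, the columns of u before j that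
    are indexed by the other rows do not contribute. So these entries of B are
    zero, and what remains of C i j is u i j * B j j. *)
Lemma column_solve (F : fieldType) n (v w : 'S_n) (u B : 'M[F]_n) (r : nat)
    (j : 'I_n) :
    is_trig_mx u -> (forall i, u i i = 1) ->
    is_trig_mx B^T -> (forall i, B i i != 0) ->
    (forall i l, (w l < v i)%N -> (u *m B) i l = 0) ->
    (forall l : 'I_n, (l <= j)%N -> (v l < r)%N -> (w l < r)%N) ->
    (v j < r)%N ->
  (forall i, (r <= v i)%N -> u i j = 0) /\
  (forall l : 'I_n, (l < j)%N -> (r <= v l)%N -> B l j = 0).
Proof.
move=> /is_trig_mxP u0 u1 /is_trig_mxP Bt B1 uB0.
have B0 (i l : 'I_n) : (l < i)%N -> B i l = 0.
  by move=> li; have := Bt l i li; rewrite mxE.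
have [k] := ubnP (nat_of_ord j); elim: k j => // k IH j jk vw vj.
have uj0 (l i : 'I_n) : (l < j)%N -> (v l < r)%N -> (r <= v i)%N -> u i l = 0.
  move=> lj vl; apply: (proj1 (IH l _ _ vl)); first exact: leq_trans lj _.
  by move=> l' l'l; apply: vw; apply: leq_trans l'l (ltnW lj).
have Bj0 (l : 'I_n) : (l < j)%N -> (r <= v l)%N -> B l j = 0.
  have [q] := ubnP (nat_of_ord l); elim: q l => // q IHq l lq lj rl.
  have := uB0 l j (leq_trans (vw j (leqnn _) vj) rl).
  rewrite mxE (bigD1 l) //= u1 mul1r big1 ?addr0 // => l' l'l.
  have [ll'|l'_le] := ltnP l l'; first by rewrite u0 ?mul0r.
  have lt_l' : (l' < l)%N by rewrite ltn_neqAle l'l.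
  have [vl'|vl'] := ltnP (v l') r.
    by rewrite (uj0 l' l (ltn_trans lt_l' lj)) ?mul0r.
  by rewrite (IHq l' (leq_trans lt_l' lq) (ltn_trans lt_l' lj)) ?mulr0.
split=> // i ri; have := uB0 i j (leq_trans (vw j (leqnn _) vj) ri).
rewrite mxE (bigD1 j) //= big1 => [|l lj].
  by move/eqP; rewrite addr0 mulf_eq0 (negPf (B1 j)) orbF => /eqP.
have [jl|l_le] := ltnP j l; first by rewrite B0 ?mulr0.
have lt_lj : (l < j)%N by rewrite ltn_neqAle lj.
have [vl|vl] := ltnP (v l) r; first by rewrite (uj0 l i) ?mul0r.
by rewrite Bj0 ?mulr0.
Qed.

(** If g u = b1 w b2, with g the matrix of v, then u b2^-1 is the matrix b1 with
    its rows permuted by v and its columns by w. *)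
Lemma cell_chartP (F : closedFieldType) n (v w : 'S_n) (x : 'rV[F]_(n * n)) :
    cell_chart w (perm_mx v)^T x ->
  exists2 B : 'M[F]_n, borel B &
    forall i l, (w l < v i)%N -> (vec_mx x *m B) i l = 0.
Proof.
case=> _ [b1 [b2 [bb1 bb2 def_x]]]; exists (invmx b2); first exact: borel_inv.
move=> i l wl; rewrite -(tr_perm_mxE v) mulmxA def_x mulmxK; last by case: bb2.
rewrite tr_perm_mx -col_permE mxE.
by have [_ /is_trig_mxP/(_ _ _ wl)] := bb1; rewrite mxE.
Qed.

Definition mx4 (R : nzRingType) (rows : seq (seq R)) : 'M[R]_4 :=
  \matrix_(i, j) nth 0 (nth [::] rows i) j.

Section Pattern3412.
Variables (F : closedFieldType) (n : nat) (w : 'S_n) (a b c d : 'I_n) (m : nat).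
Hypotheses (ab : (a < b)%N) (bc : (b < c)%N) (cd : (c < d)%N).
Hypotheses (wa : w a = m.+2 :> nat) (wb : w b = m.+3 :> nat).
Hypotheses (wc : w c = m :> nat) (wd : w d = m.+1 :> nat).

Let s : 'S_n := (tperm a c * tperm a d * tperm a b)%g.
(** v differs from w only at a, b, c, d, where its values are in the order 1324
    instead of 3412. In the chart at v, the Schubert variety of w is the product
    of an affine space and of the Schubert variety of 3412 in the chart at 1324,
    which is a quadric cone times a line; the point u = 1 is a vertex. *)
Let v : 'S_n := (s * w)%g.
Let g : 'M[F]_n := (perm_mx v)^T.
Let f (i : 'I_4) : 'I_n := nth a [:: a; b; c; d] i.

Let neqs : [/\ (a != b), (a != c), (a != d), (b != c) & (b != d) && (c != d)].
Proof. by rewrite -!val_eqE /=; split; lia. Qed.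

Lemma s_values : [/\ s a = c, s b = a, s c = d & s d = b].
Proof.
have [nab nac nad nbc /andP[nbd ncd]] := neqs.
have [ncb ndc ndb] : [/\ c != b, d != c & d != b] by split; rewrite eq_sym.
rewrite /s !permM; split.
- by rewrite tpermL (tpermD nac ndc) (tpermD nac nbc).
- by rewrite (tpermD nab ncb) (tpermD nab ndb) tpermR.
- by rewrite tpermR tpermL (tpermD nad nbd).
- by rewrite (tpermD nad ncd) tpermR tpermL.
Qed.

Lemma s_out l : l \notin [:: a; b; c; d] -> s l = l.
Proof.
rewrite !inE !negb_or => /and4P[la lb lc ld].
by rewrite /s !permM !tpermD // eq_sym.
Qed.

Lemma v_values :
  [/\ v a = m :> nat, v b = m.+2 :> nat, v c = m.+1 :> nat & v d = m.+3 :> nat].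
Proof.
have [sa sb sc sd] := s_values.
by split; rewrite permM ?sa ?sb ?sc ?sd.
Qed.

Lemma v_out l : l \notin [:: a; b; c; d] ->
  v l = w l /\ ((v l < m)%N \/ (m.+3 < v l)%N).
Proof.
move=> lo; have vl : v l = w l by rewrite permM s_out.
split=> //; rewrite vl; move: lo; rewrite !inE !negb_or => /and4P[la lb lc ld].
have wneq (x : 'I_n) : l != x -> nat_of_ord (w l) <> w x.
  by move=> lx /val_inj/perm_inj e; rewrite e eqxx in lx.
by have := wneq _ la; have := wneq _ lb; have := wneq _ lc; have := wneq _ ld; lia.
Qed.

Lemma f_inj : injective f.
Proof.
have [nab nac nad nbc /andP[nbd ncd]] := neqs.
have uf : uniq [:: a; b; c; d] by rewrite /= !inE !negb_or nab nac nad nbc nbd ncd.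
move=> i j /eqP; rewrite nth_uniq //; first by move/eqP/val_inj.
Qed.

Lemma f_lt (i j : 'I_4) : (f i < f j)%N = (i < j)%N.
Proof.
by case: i => [[|[|[|[|i]]]] ?] //; case: j => [[|[|[|[|j]]]] ?] //;
   rewrite /f /=; lia.
Qed.

Lemma f_codom l : reflect (exists i, l = f i) (l \in [:: a; b; c; d]).
Proof.
apply: (iffP idP) => [|[i ->]]; last by rewrite /f mem_nth.
move=> lo; exists (inord (index l [:: a; b; c; d])).
by rewrite /f inordK ?nth_index //; rewrite -index_mem in lo.
Qed.

Lemma perm_mx_s : (perm_mx s)^T =
  embed f (mx4 [:: [:: 0; 1; 0; 0]; [:: 0; 0; 0; 1]; [:: 1; 0; 0; 0]; [:: 0; 0; 1; 0]])
    :> 'M[F]_n.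
Proof.
have [sa sb sc sd] := s_values.
have sf (j : 'I_4) : exists i, s (f j) = f i.
  case: j => [[|[|[|[|j]]]] ?] //; rewrite /f /= ?sa ?sb ?sc ?sd; apply/f_codom;
  by rewrite !inE eqxx ?orbT.
apply/matrixP => r l; rewrite 3![LHS]mxE.
have [/f_codom[j ->]|lo] := boolP (l \in [:: a; b; c; d]); last first.
  rewrite s_out // embed_out 1?eq_sym // => i j _ lj.
  by case/f_codom: lo; exists j.
have [/f_codom[i ->]|ro] := boolP (r \in [:: a; b; c; d]); last first.
  rewrite embed_out => [|i ? ri _]; last by case/f_codom: ro; exists i.
  have [i ->] := sf j; rewrite !(negbTE (memPn ro _ _)) ?(eq_sym r) //.
    by rewrite (negbTE (memPn ro _ _)) //; apply/f_codom; exists j.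
  by apply/f_codom; exists i.
rewrite embedE ?mxE; last exact: f_inj.
case: j => [[|[|[|[|j]]]] ?] //; rewrite /f /= ?sa ?sb ?sc ?sd;
by case: i => [[|[|[|[|i]]]] ?] //=; rewrite ?eqxx // -val_eqE;
  case: eqP => // /= *; lia.
Qed.

(** The values m, ..., m + 3 being consecutive, the thresholds r <= m and
    r > m + 3 do not distinguish v from w; with them [column_solve] kills all
    entries of u at inversions (j, i) of v with i, j not both among a, b, c, d.
    The last equation, the quadric cone up to a change of coordinates, expresses
    that the rows b, c, d of u have rank less than 3 in the columns a, b, c,
    because w c = m is less than the values of v at b, c, d. *)
Lemma cell_equations (x : 'rV[F]_(n * n)) (u := vec_mx x) :
    cell_chart w g x ->
  (forall i j : 'I_n, (j < i)%N -> ~~ (v i < v j)%N ->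
     (i, j) \notin [:: (b, a); (c, a); (d, b); (d, c)] -> u i j = 0) /\
  u d c * (u c a - u c b * u b a) + u b a * u d b = 0.
Proof.
move=> cx; have [u0 u1] := proj1 cx; rewrite -/u in u0 u1.
have [B [uB tB] uB0] := cell_chartP cx; rewrite -/u in uB0.
have dB i : B i i != 0.
  by have := trig_unit_diag i tB; rewrite unitmx_tr mxE; apply.
have solve r j := column_solve (r := r) (j := j) u0 u1 tB dB uB0.
have [va vb vc vd] := v_values.
have vw r (l : 'I_n) : (r <= m)%N \/ (m.+3 < r)%N -> (v l < r)%N -> (w l < r)%N.
  move=> mr; have [lo|/v_out[-> //]] := boolP (l \in [:: a; b; c; d]).
  by move: lo; rewrite !inE => /or4P[] /eqP->;
    rewrite ?va ?vb ?vc ?vd ?wa ?wb ?wc ?wd; lia.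
(* Here the threshold m + 3 will do: v = w before a, and w a = m + 2. *)
have uda : u d a = 0.
  apply: (proj1 (solve m.+3 a _ _)); rewrite ?va ?vd //; last lia.
  move=> l la vl; have [lo|/v_out[<- //]] := boolP (l \in [:: a; b; c; d]).
  by move: lo la; rewrite !inE => /or4P[] /eqP->; rewrite ?wa //; lia.
split.
  move=> i j ji vij nij.
  have vji : (v j < v i)%N.
    rewrite ltn_neqAle leqNgt vij andbT; apply/negP => /eqP/val_inj/perm_inj e.
    by rewrite e ltnn in ji.
  have go r : (r <= m)%N \/ (m.+3 < r)%N -> (v j < r <= v i)%N -> u i j = 0.
    move=> mr /andP[jr ri]; apply: (proj1 (solve r j _ jr)) => // l _.
    exact: vw.
  have vi := @v_out i; have vj := @v_out j.
  case: (boolP (j \in [:: a; b; c; d])) vj => [jo _|jo]; last first.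
    by case=> // _ vj; apply: (go (v j).+1); lia.
  case: (boolP (i \in [:: a; b; c; d])) vi => [io _|io]; last first.
    case=> // _ vi; apply: (go m.+4); first by right.
    move: jo vji; rewrite !inE => /or4P[] /eqP ->;
      rewrite ?va ?vb ?vc ?vd; lia.
  have [[-> ->] //|] := eqVneq (i, j) (d, a).
  move: jo io nij vji ji; rewrite !inE !xpair_eqE.
  clear -ab bc cd va vb vc vd.
  by move=> /or4P[] /eqP-> /or4P[] /eqP->; rewrite ?eqxx ?orbT //= ?va ?vb ?vc ?vd; lia.
have [_ Bc] : (forall i, (m.+4 <= v i)%N -> u i c = 0) /\
    (forall l : 'I_n, (l < c)%N -> (m.+4 <= v l)%N -> B l c = 0).
  by apply: solve => [l _|]; [apply: vw; lia | rewrite vc; lia].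
have ulow (i l : 'I_n) : (v l < m)%N -> (m <= v i)%N -> u i l = 0.
  by move=> vl vi; apply: (proj1 (solve m l _ vl)) => // l' _; apply: vw; lia.
have tri (i j : 'I_n) : (i < j)%N -> u i j = 0 by apply: is_trig_mxP.
(* Column c of B gives a linear relation between the columns a, b, c of u. *)
have lin (i : 'I_n) : (m < v i)%N ->
    u i a * B a c + (u i b * B b c + u i c * B c c) = 0.
  move=> vi; have := uB0 i c; rewrite wc => /(_ vi); rewrite mxE.
  have [nab nac nad nbc /andP[nbd ncd]] := neqs.
  rewrite (bigD1 a) // (bigD1 b) 1?eq_sym // (bigD1 c) /=; last first.
    by rewrite eq_sym nac eq_sym nbc.
  rewrite big1 ?addr0 // => l /andP[/andP[la lb] lc].
  have [cl|l_le] := ltnP c l.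
    by have := is_trig_mxP tB c l cl; rewrite mxE => ->; rewrite mulr0.
  have lt_lc : (l < c)%N by rewrite ltn_neqAle lc.
  have [|vl] : (v l < m)%N \/ (m.+3 < v l)%N.
  - apply: (proj2 (v_out _)); rewrite !inE !negb_or la lb lc /=.
    by apply: contraTneq lt_lc => ->; rewrite -leqNgt ltnW.
  - by move=> vl; rewrite (ulow i l vl (ltnW vi)) mul0r.
  - by rewrite Bc ?mulr0.
have := lin b; have := lin c; have := lin d.
rewrite vb vc vd (tri b c) // !u1 !mul1r mul0r addr0.
rewrite uda mul0r add0r => ed ec eb.
have {}ed := ed _; have {}ec := ec _; have {}eb := eb _.
have Bb : B b c = - (u b a * B a c) by apply/eqP; rewrite -addr_eq0 addrC eb //; lia.
have Bcc : B c c = - ((u c a - u c b * u b a) * B a c).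
  apply/eqP; rewrite -addr_eq0 -(ec _) ?Bb; first by apply/eqP; ring.
  lia.
have Ba : B a c != 0.
  by apply: contraNneq (dB c) => B0; rewrite Bcc B0 mulr0 oppr0.
apply: (mulIf Ba); rewrite mul0r -[RHS]oppr0 -(ed _) ?Bb ?Bcc; first by ring.
lia.
Qed.

(** For nonzero x, h, z, the points of the quadric cone with no zero coordinate:
    with rows and columns at a, b, c, d, the product of the entries (b, a) and
    (d, b) is opposite to that of the entries (c, a) and (d, c). *)
Definition cone_mx (x h z : F) : 'M[F]_4 :=
  mx4 [:: [:: 0; 0; 0; 0]; [:: x; 0; 0; 0]; [:: - (x * h); 0; 0; 0];
          [:: 0; h * z; z; 0]].

Definition cell_pt (N : 'M[F]_n) (x h z : F) : 'M[F]_n :=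
  (1%:M + N) *m embed f (1%:M + cone_mx x h z).

(** The unipotent matrices u = 1 + N with this property are such that g u = b g
    with b upper triangular. *)
Definition upward (N : 'M[F]_n) : Prop :=
  forall i j : 'I_n, ~~ ((j < i)%N && (v i < v j)%N) -> N i j = 0.

(** Outside of the four positions a, b, c, d, this is because conjugation by g
    makes 1 + N upper triangular. On them, it comes from an explicit
    factorization S A = Bl Br of 4 by 4 matrices, S the permutation matrix that
    changes the pattern 3412 into 1324, in which Br is upper triangular, and Bl
    becomes so once its rows and columns are sorted by the values of w. *)
Lemma cell_pt_in_cell N x h z : upward N -> x != 0 -> h != 0 -> z != 0 ->
  cell_chart w g (mxvec (cell_pt N x h z)).
Proof.
move=> upN x0 h0 z0; rewrite /cell_chart mxvecK.
set A := 1%:M + cone_mx x h z.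
have lA : lower_unipotent (embed f A).
  split=> [|i].
    apply/is_trig_mxP => i j.
    apply: (@embed_eq0 _ _ _ f A (fun i j : 'I_n => (i < j)%N)) => [||i' j'].
    - exact: f_inj.
    - by move=> l; rewrite ltnn.
    rewrite f_lt !mxE; case: i' => [[|[|[|[|i']]]] ?] //;
    by case: j' => [[|[|[|[|j']]]] ?] //= _; rewrite addr0.
  have [/f_codom[i' ->]|io] := boolP (i \in [:: a; b; c; d]).
    rewrite embedE ?mxE; last exact: f_inj.
    by rewrite eqxx; case: i' => [[|[|[|[|i']]]] ?] //=; rewrite addr0.
  rewrite embed_out ?eqxx // => i' _ ei _; case/f_codom: io; by exists i'.
have lN : lower_unipotent (1%:M + N).
  split=> [|i]; last by rewrite !mxE eqxx upN ?addr0 // ltnn.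
  apply/is_trig_mxP => i j ij; rewrite !mxE -val_eqE ltn_eqF // add0r upN //.
  by rewrite negb_and -leqNgt (ltnW ij).
split; first exact: lower_unipotent_mul.
rewrite mulmxA; have [||q bq ->] := @perm_mx_conj F n v (1%:M + N).
- exact: lower_unipotent_unit.
- move=> i j vji; rewrite !mxE upN ?addr0; last first.
    by rewrite negb_and -[X in _ || X]leqNgt (ltnW vji) orbT.
  by have [ij|] := eqVneq i j; rewrite // ij ltnn in vji.
rewrite -mulmxA; apply: bruhat_cell_mull => //.
pose Bl : 'M[F]_4 := mx4 [:: [:: x; 1; 0; 0]; [:: 0; h * z; 0; 0];
  [:: 1; 0; 1; 0]; [:: - (x * h); 0; 0; - z^-1]].
pose Br : 'M[F]_4 := mx4 [:: [:: 1; 0; - (x * h)^-1; - (x * h * z)^-1];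
  [:: 0; 1; h^-1; (h * z)^-1]; [:: 0; 0; (x * h)^-1; (x * h * z)^-1];
  [:: 0; 0; 0; 1]].
have def_gA : (perm_mx s)^T *m embed f A = embed f Bl *m embed f Br.
  rewrite perm_mx_s !embedM; try exact: f_inj; congr (embed f _).
  apply/matrixP => i j; rewrite !mxE !big_ord_recl !big_ord0 !mxE /=.
  case: i => [[|[|[|[|i]]]] ?] //; case: j => [[|[|[|[|j]]]] ?] //=;
    field; by rewrite ?x0 ?h0 ?z0.
have : embed f Bl *m embed f Br \in unitmx.
  by rewrite -def_gA unitmx_mul unitmx_tr unitmx_perm lower_unipotent_unit.
rewrite unitmx_mul => /andP[uBl uBr].
rewrite {1}/v perm_mxM trmx_mul -mulmxA def_gA mulmxA.
apply: bruhat_cell_mulr.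
  split=> //; apply/is_trig_mxP => i j; rewrite mxE.
  apply: (@embed_eq0 _ _ _ f Br (fun j i : 'I_n => (i < j)%N)) => [||i' j'].
  - exact: f_inj.
  - by move=> l; rewrite ltnn.
  rewrite f_lt !mxE; case: i' => [[|[|[|[|i']]]] ?] //;
  by case: j' => [[|[|[|[|j']]]] ?].
have [//||b1 bb1 ->] := @perm_mx_conj F n w (embed f Bl).
  apply: (@embed_eq0 _ _ _ f Bl (fun i j : 'I_n => (w j < w i)%N)) => [||i' j'].
  - exact: f_inj.
  - by move=> l; rewrite ltnn.
  rewrite !mxE; case: i' => [[|[|[|[|i']]]] ?] //;
  case: j' => [[|[|[|[|j']]]] ?] //; rewrite /f /= ?wa ?wb ?wc ?wd //; lia.
exists b1, 1%:M; split=> //; last by rewrite mulmx1.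
by split; rewrite ?unitmx1 // trmx1 scalar_mx_is_trig.
Qed.

(** The entries of u that are not killed by the linear equations of the cell. *)
Definition allowed (i j : 'I_n) : bool :=
  (j < i)%N && ((v i < v j)%N || ((i, j) \in [:: (b, a); (c, a); (d, b); (d, c)])).

(** Scaling N, x and z by t gives a curve in the cell for nonzero t, which passes
    at t = 0 through the point 1 with velocity D. *)
Lemma cell_curve f0 N x h z (D := N + frame F f *m cone_mx x h z *m (frame F f)^T) :
    vanishes_on (cell_chart w g) f0 ->
    upward N -> x != 0 -> h != 0 -> z != 0 ->
  f0.@[mxvec 1%:M 0] = 0 /\
  \sum_i \sum_j f0^`M(mxvec_index i j).@[mxvec 1%:M 0] * D i j = 0.
Proof.
move=> v0 upN x0 h0 z0.
pose C := frame F f *m cone_mx x h z *m (frame F f)^T.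
have ptE t : cell_pt (t *: N) (t * x) h (t * z)
    = 1%:M + t *: D + t ^+ 2 *: (N *m C).
  rewrite /cell_pt /embed [1%:M + cone_mx _ _ _]addrC addrK.
  have -> : cone_mx (t * x) h (t * z) = t *: cone_mx x h z.
    apply/matrixP => i j; rewrite !mxE.
    by case: i => [[|[|[|[|i]]]] ?] //; case: j => [[|[|[|[|j]]]] ?] //=; ring.
  rewrite -scalemxAr -scalemxAl -/C mulmxDl mul1mx mulmxDr mulmx1.
  rewrite -scalemxAr -scalemxAl scalerA -expr2 /D -/C scalerDr.
  by rewrite addrA [in RHS]addrA [1%:M + t *: C + _]addrAC.
clearbody D.
pose P k : {poly F} := (mxvec 1%:M 0 k)%:P + mxvec D 0 k *: 'X
  + mxvec (N *m C) 0 k *: 'X^2.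
have PE t : \row_k (P k).[t] = mxvec (cell_pt (t *: N) (t * x) h (t * z)).
  rewrite ptE !linearD !linearZ /= /P.
  move: (mxvec D) (mxvec (N *m C)) (mxvec 1%:M) => vD vC v1.
  apply/rowP => k; rewrite !mxE !hornerD !hornerZ hornerC hornerX hornerXn.
  by ring.
have P0 k : (P k).[0] = mxvec 1%:M 0 k.
  by rewrite !hornerD !hornerZ hornerC hornerX hornerXn expr0n !mulr0 !addr0.
have SP t : t != 0 -> cell_chart w g (\row_k (P k).[t]).
  move=> t0; rewrite PE; apply: cell_pt_in_cell; rewrite ?mulf_neq0 //.
  by move=> i j ij; rewrite mxE upN ?mulr0.
split.
  have := congr1 (horner^~ 0) (curve_limit SP v0); rewrite alongE horner0 => <-.
  by apply: meval_eq => k; rewrite P0.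
rewrite -(sum_mxvec (fun k => f0^`M(k).@[mxvec 1%:M 0]) D).
rewrite -[RHS](curve_tangent SP v0); apply: eq_bigr => k _; congr (_ * _).
  by apply: meval_eq => k'; rewrite P0.
rewrite !derivD !derivZ derivC derivX derivXn !hornerD !hornerZ hornerMn hornerX.
by rewrite horner0 hornerC mul0rn mulr0 mulr1 add0r addr0.
Qed.

(** The velocities of the curves above span the space of all matrices supported
    on the allowed entries, because a nondegenerate quadric cone spans its
    ambient space. *)
Lemma tangent_at_1 (f0 : {mpoly F[n * n]}) i j :
    vanishes_on (cell_chart w g) f0 -> allowed i j ->
  f0^`M(mxvec_index i j).@[mxvec 1%:M 0] = 0.
Proof.
move=> v0 aij; pose D i j := f0^`M(mxvec_index i j).@[mxvec 1%:M 0].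
have coneE N x h z : upward N -> x != 0 -> h != 0 -> z != 0 ->
  \sum_i \sum_j D i j * N i j +
  (D b a * x - D c a * (x * h) + D d b * (h * z) + D d c * z) = 0.
  move=> upN x0 h0 z0; have [_ e] := cell_curve v0 upN x0 h0 z0.
  rewrite -[RHS]e.
  pose M := \matrix_(i, j) D i j.
  have -> : D b a * x - D c a * (x * h) + D d b * (h * z) + D d c * z =
     \sum_i \sum_j M (f i) (f j) * cone_mx x h z i j.
    by rewrite !big_ord_recl !big_ord0 !mxE /f /=; ring.
  rewrite -(sum_frame f) -big_split; apply: eq_bigr => i' _.
  rewrite -big_split; apply: eq_bigr => j' _ /=.
  by rewrite [M _ _]mxE [X in _ = _ * X]mxE mulrDr.
have up0 : upward (0 : 'M[F]_n) by move=> i' j' _; rewrite mxE.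
have cone0 x h z : x != 0 -> h != 0 -> z != 0 ->
    D b a * x - D c a * (x * h) + D d b * (h * z) + D d c * z = 0.
  move=> x0 h0 z0; rewrite -[RHS](coneE 0 x h z) //.
  rewrite (_ : \sum_i _ = 0) ?add0r // big1 // => i' _; rewrite big1 // => j' _.
  by rewrite mxE mulr0.
have [/andP[ji /orP[vij|]]] := aij.
  have := coneE (delta_mx i j) 1 1 1; rewrite cone0 ?oner_neq0 // addr0.
  rewrite (bigD1 i) //= (bigD1 j) //= !big1 => [|i' i'i|j' j'j].
  - rewrite mxE !eqxx mulr1 !addr0; apply; rewrite ?oner_neq0 //.
    move=> i' j'; rewrite mxE; case: eqP => [->|//]; case: eqP => [->|//] /=.
    by rewrite ji vij.
  - by rewrite big1 // => j' _; rewrite mxE (negPf i'i) mulr0.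
  - by rewrite mxE (negPf j'j) andbF mulr0.
have n1 := oner_neq0 F.
(* In any characteristic, a third element of F is a root of X^2 - X + 1. *)
have [l /andP[l0 l1]] : exists l : F, (l != 0) && (l != 1).
  have : size (Poly [:: 1; -1; 1 : F]) != 1%N by rewrite (@PolyK _ 0) /=.
  case/closed_rootP => l; rewrite rootE horner_Poly /= => /eqP l_root.
  exists l; apply/andP; split; apply: contraNneq n1 => e;
    by rewrite e in l_root; apply/eqP; rewrite -l_root; ring.
have sl1 : l - 1 != 0 by rewrite subr_eq0.
(* Used below at four linearly independent vectors of the cone. *)
pose E x h z := D b a * x - D c a * (x * h) + D d b * (h * z) + D d c * z.
have E0 x h z : x != 0 -> h != 0 -> z != 0 -> E x h z = 0 by apply: cone0.
have Dca : D c a = 0.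
  apply: (mulfI (mulf_neq0 sl1 sl1)); rewrite mulr0.
  transitivity (E l 1 1 + E 1 l 1 - E l l 1 - E 1 1 1); first by rewrite /E; ring.
  by rewrite !E0 // !subr0 addr0.
have Dba : D b a = 0.
  apply: (mulfI sl1); rewrite mulr0.
  transitivity (E l 1 1 - E 1 1 1); first by rewrite /E Dca; ring.
  by rewrite !E0 // subr0.
have Ddb : D d b = 0.
  apply: (mulfI sl1); rewrite mulr0.
  transitivity (E 1 l 1 - E 1 1 1); first by rewrite /E Dca; ring.
  by rewrite !E0 // subr0.
have Ddc : D d c = 0 by rewrite -(E0 1 1 1) // /E Dca Dba Ddb; ring.
rewrite !inE !xpair_eqE.
by case/or4P=> /andP[/eqP-> /eqP->]; [exact: Dba|exact: Dca|exact: Ddb|exact: Ddc].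
Qed.

Lemma tangent_allowed (D : 'M[F]_n) : (forall i j, ~~ allowed i j -> D i j = 0) ->
  is_tangent (schubert_chart w g) (mxvec 1%:M) (mxvec D).
Proof.
move=> D0 f0 v0; rewrite (sum_mxvec (fun k => f0^`M(k).@[mxvec 1%:M 0]) D).
have v0' : vanishes_on (cell_chart w g) f0 by move=> x /sub_closure/v0.
rewrite big1 // => i _; rewrite big1 // => j _.
have [aij|/D0->] := boolP (allowed i j); last by rewrite mulr0.
by rewrite tangent_at_1 ?mul0r.
Qed.

Lemma allowed_tangent p x i j : is_tangent (schubert_chart w g) p x ->
  ~~ allowed i j -> vec_mx x i j = 0.
Proof.
move=> tx aij; rewrite mxE.
have := @tangent_line _ _ _ p x ('X_(mxvec_index i j) - (i == j)%:R%:MP) tx.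
rewrite alongB alongX alongC derivB derivD derivC derivZ derivX derivC subr0 add0r.
rewrite hornerZ hornerC mulr1; apply; apply: vanishes_on_closure => y cy.
rewrite mevalB mevalXU mevalC; have [t1 d1] := proj1 cy.
have [->|] := eqVneq i j; first by have := d1 j; rewrite mxE => ->; rewrite subrr.
rewrite subr0; have -> : y 0 (mxvec_index i j) = vec_mx y i j by rewrite mxE.
rewrite -val_eqE /= neq_ltn => /orP[ij|ji]; first exact: (is_trig_mxP t1).
move: aij; rewrite /allowed ji negb_or /= => /andP[vij nij].
exact: (proj1 (cell_equations cy)).
Qed.

(** The tangent space at the vertex 1 is the space of matrices supported on the
    allowed entries. It contains the tangent space at p, a point where the
    differential of the quadric is not zero in the direction (d, b): so the
    inclusion is strict, which a smooth variety does not permit. *)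
Lemma not_smooth_of_consecutive_3412 : ~ smooth_perm F w.
Proof.
move=> sm_w; have ug : g \in unitmx by rewrite unitmx_tr unitmx_perm.
have n1 := oner_neq0 F.
have up0 : upward (0 : 'M[F]_n) by move=> i j _; rewrite mxE.
have Y1 : schubert_chart w g (mxvec 1%:M).
  by move=> f0 v0; have [] := cell_curve v0 up0 n1 n1 n1.
pose p := cell_pt 0 1 1 1.
have Yp : schubert_chart w g (mxvec p) by apply/sub_closure/cell_pt_in_cell.
have incl x : is_tangent (schubert_chart w g) (mxvec p) x ->
    is_tangent (schubert_chart w g) (mxvec 1%:M) x.
  move=> tx; rewrite -[x]vec_mxK; apply: tangent_allowed => i j.
  exact: allowed_tangent tx.
have := smooth_tangent_incl (sm_w g ug) Y1 Yp incl (v := mxvec (delta_mx d b)).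
have [nab nac nad nbc /andP[nbd ncd]] := neqs.
have {incl} t1 : is_tangent (schubert_chart w g) (mxvec 1%:M) (mxvec (delta_mx d b)).
  apply: tangent_allowed => i j; rewrite mxE; case: eqP => [->|//].
  case: eqP => [->|//]; rewrite /allowed (ltn_trans bc cd) /=.
  by rewrite !inE eqxx !orbT.
move/(_ t1) => tp.
pose X i j : {mpoly F[n * n]} := 'X_(mxvec_index i j).
have := tangent_line (f := X d c * (X c a - X c b * X b a) + X b a * X d b) tp.
rewrite !(alongB, alongD, alongM, alongX) !mxvecE.
have pE (i j : 'I_4) : p (f i) (f j) = (i == j)%:R + cone_mx 1 1 1 i j.
  by rewrite /p /cell_pt addr0 mul1mx embedE 1?mxE ?mxE //; apply: f_inj.
pose o i lt_i4 := @Ordinal 4 i lt_i4.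
have pba : p b a = 1.
  by apply: etrans (pE (o 1 isT) (o 0 isT)) _; rewrite mxE /= add0r.
have pca : p c a = -1.
  by apply: etrans (pE (o 2 isT) (o 0 isT)) _; rewrite mxE /= add0r mulr1.
have pcb : p c b = 0.
  by apply: etrans (pE (o 2 isT) (o 1 isT)) _; rewrite mxE /= add0r.
have pdb : p d b = 1.
  by apply: etrans (pE (o 3 isT) (o 1 isT)) _; rewrite mxE /= add0r mulr1.
have pdc : p d c = 1.
  by apply: etrans (pE (o 3 isT) (o 2 isT)) _; rewrite mxE /= add0r.
pose E := delta_mx d b : 'M[F]_n.
have Edc : E d c = 0 by rewrite mxE (eq_sym c) (negPf nbc) andbF.
have Eca : E c a = 0 by rewrite mxE (negPf ncd).
have Ecb : E c b = 0 by rewrite mxE (negPf ncd).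
have Eba : E b a = 0 by rewrite mxE (negPf nbd).
have Edb : E d b = 1 by rewrite mxE !eqxx.
rewrite pba pca pcb pdb pdc Edc Eca Ecb Eba Edb !scale0r scale1r.
rewrite !addr0 polyCN polyC1 polyC0 !mul1r mul0r subr0 addKr derivX hornerC.
move=> e; have/e/eqP : vanishes_on (schubert_chart w g)
   (X d c * (X c a - X c b * X b a) + X b a * X d b).
  apply: vanishes_on_closure => y /cell_equations[_ <-].
  by rewrite !(mevalB, mevalD, mevalM, mevalXU) !mxE.
by rewrite (negPf n1).
Qed.

End Pattern3412.

Local Close Scope ring_scope.

(** * Words with a given two-row insertion tableau *)

Lemma row_insert_mem x r : x \in (row_insert x r).1.
Proof.
elim: r => [|y r IH] /=; first by rewrite mem_head.
case: ifP => _; first by rewrite mem_head.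
by case: (row_insert x r) IH => r' b /= IH; rewrite inE IH orbT.
Qed.

Lemma row_insert_keep x r y :
  y \in r -> y \in (row_insert x r).1 \/ (row_insert x r).2 = Some y.
Proof.
elim: r => [|z r IH] //=; rewrite inE; case: ifP => _.
  by case/predU1P=> [->|yr]; [right | left; rewrite inE yr orbT].
case: (row_insert x r) IH => r' b /= IH /predU1P[->|/IH[yr|->]].
- by left; rewrite mem_head.
- by left; rewrite inE yr orbT.
- by right.
Qed.

Lemma row_insert_bump x r s : has (ltn x) r ->
  exists2 y, (row_insert x (r ++ s)).2 = Some y & (x < y) && (y \in r).
Proof.
elim: r => [|z r IH] //=; case: ifP => [xz _|_ /= /IH[y]].
  by exists z; rewrite ?xz ?mem_head.
case: (row_insert x _) => r' b /= -> /andP[xy yr].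
by exists y; rewrite // xy inE yr orbT.
Qed.

Lemma row_insert_cat x r s : all (geq x) r ->
  row_insert x (r ++ s) = (r ++ (row_insert x s).1, (row_insert x s).2).
Proof.
elim: r => [|y r IH] /=; first by case: (row_insert x s).
by case/andP=> yx /IH ->; rewrite ltnNge yx.
Qed.

Lemma row_insert_end x r : all (geq x) r -> row_insert x r = (rcons r x, None).
Proof. by move=> le_r; rewrite -[r in LHS]cats0 row_insert_cat //= cats1. Qed.

(** Rows only lose entries to lower rows. So if an entry <= p is in the second row,
    or there is a third row, it will never be otherwise; and if x > p in the first
    row is less than an entry of the second row, either x stays there forever or
    its arrival in the second row creates a third row. Hence a doomed tableau never
    becomes a two-row tableau with entries <= p in the first row and > p in the
    second one. *)
Definition doomed p (t : seq (seq nat)) : bool :=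
  match t with
  | r1 :: r2 :: t' =>
      [|| t' != [::], has (geq p) r2
        | has (fun x => (p < x) && has (ltn x) r2) r1]
  | _ => false
  end.

Lemma doomed_insert p t z : doomed p t -> doomed p (tableau_insert t z).
Proof.
case: t => [|r1 [|r2 t']] //= dt.
have := @row_insert_keep z r1; case: (row_insert z r1) => r1' [y|] /= sub1.
  have := @row_insert_keep y r2; have := @row_insert_bump y r2 [::].
  rewrite cats0; case: (row_insert y r2) => r2' [y2|] /= bump sub2.
    by case: t' {dt} => [|r3 t3] //=; case: (row_insert _ _) => ? [].
  have {}sub2 u : u \in r2 -> u \in r2' by case/sub2.
  case/or3P: dt => [-> //|/hasP[u ur pu]|/hasP[u ur /andP[pu ru]]].
    by apply/or3P/Or32/hasP; exists u; auto.
  have [u1|[yu]] := sub1 u ur.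
    apply/or3P/Or33/hasP; exists u; rewrite // pu.
    by case/hasP: ru => v vr uv; apply/hasP; exists v; auto.
  by rewrite yu in bump; case: (bump ru).
case/or3P: dt => [-> //|->|/hasP[u ur /andP[pu ru]]]; rewrite ?orbT //.
apply/or3P/Or33/hasP; exists u; rewrite ?pu //.
by case: (sub1 u ur).
Qed.

Lemma doomed_foldl p t l : doomed p t -> doomed p (foldl tableau_insert t l).
Proof. by elim: l t => //= x l IH t dt; apply/IH/doomed_insert. Qed.

(** Empty rows are left out, as in the tableaux built by insertion. *)
Definition two_rows (r1 r2 : seq nat) : seq (seq nat) :=
  if r1 is [::] then [::] else if r2 is [::] then [:: r1] else [:: r1; r2].

Lemma two_rows_insert r1 r2 x : (r1 = [::] -> r2 = [::]) ->
  tableau_insert (two_rows r1 r2) x =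
    match row_insert x r1 with
    | (r1', None) => two_rows r1' r2
    | (r1', Some y) =>
        match row_insert y r2 with
        | (r2', None) => two_rows r1' r2'
        | (r2', Some z) => [:: r1'; r2'; [:: z]]
        end
    end.
Proof.
case: r1 => [->|y1 r1 _] //.
have r1x := row_insert_mem x (y1 :: r1).
case: r2 => [|y2 r2]; rewrite /two_rows /tableau_insert -/tableau_insert;
  case: (row_insert x _) r1x => [[|z r1'] [y|]] //= _.
have := row_insert_mem y (y2 :: r2).
rewrite /=; case: ifP => // _; case: (row_insert y r2) => r2' [z2|] //.
Qed.

(** Call small the entries <= p, big the other ones. As long as the tableau is not
    doomed, its first row consists of A, all small entries read so far, followed
    by B, big entries, and its second row is C, big entries less than those of B.
    A new big entry is put at the end of B, a new small one is put at the end
    of A and moves the first entry of B, if any, to the end of C. As B is empty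
    at the end, small and big entries both are read in increasing order, and each
    big entry is matched with a later small one, which moves it. *)
Lemma shuffle_of_insertion p A B C l R1 R2 :
    all (geq p) A -> all (ltn p) B -> all (ltn p) C -> sorted leq (C ++ B) ->
    (A ++ B = [::] -> C = [::]) ->
    foldl tableau_insert (two_rows (A ++ B) C) l = [:: R1; R2] ->
    all (geq p) R1 -> all (ltn p) R2 ->
  [/\ R1 = A ++ filter (geq p) l, R2 = C ++ B ++ filter (ltn p) l,
      size B + count (ltn p) l <= count (geq p) l &
      forall i, count (ltn p) (drop i l) <= count (geq p) (drop i l)].
Proof.
move=> + + + + + + R1s R2b; elim: l A B C => [|x l IH] A B C As Bb Cb CB ABC.
  rewrite /= => tR; have [eR1 eR2] : A ++ B = R1 /\ C = R2.
    by move: tR {R1s As Bb CB ABC}; rewrite /two_rows; case: (A ++ B) => // a r;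
      case: C {Cb R2b} => // c C [-> ->].
  have B0 : B = [::].
    case: B eR1 Bb {CB ABC tR} => // b B eR1 /andP[/= pb _].
    move: R1s; rewrite -eR1 all_cat /= => /and3P[_ /=].
    by rewrite leqNgt pb.
  by rewrite B0 cats0 in eR1 *; rewrite !cats0; split=> //= -[|i].
have ndR : ~~ doomed p [:: R1; R2].
  rewrite /= negb_or -!all_predC; apply/andP; split.
    by apply: sub_all R2b => y /=; rewrite -ltnNge.
  by apply: sub_all R1s => y /= yp; rewrite ltnNge yp.
rewrite /= two_rows_insert //.
(* Each move that breaks the description above produces a doomed tableau. *)
have nd t : doomed p t -> foldl tableau_insert t l <> [:: R1; R2].
  by move=> dt eR; move: ndR; rewrite -eR doomed_foldl.
have last_step (B' : seq nat) :
  size B' + count (ltn p) l <= count (geq p) l ->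
  (forall i, count (ltn p) (drop i l) <= count (geq p) (drop i l)) ->
  size B + (p < x) <= size B' + (x <= p) ->
  size B + ((p < x) + count (ltn p) l) <= (x <= p) + count (geq p) l /\
  forall i, count (ltn p) (drop i (x :: l)) <= count (geq p) (drop i (x :: l)).
  by move=> h1 h2 h3; split=> [|[|i]] //=; lia.
case: (leqP x p) => xp; last first.
  have Ax : all (geq x) A by apply: sub_all As => y /=; lia.
  have [xB|xB] := boolP (has (ltn x) B).
    have [y by_ /andP[xy yB]] := row_insert_bump [::] xB.
    have xr := row_insert_mem x B.
    rewrite cats0 in by_; rewrite row_insert_cat // by_.
    have := row_insert_mem y C; case: (row_insert y C) => r2' [z2|] /= yr eR.
      by case: (nd _ _ eR).
    case: (nd _ _ eR); move: eR; rewrite /two_rows.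
    case Er: (A ++ _) => [|a r]; first by case: A Er {As Ax ABC} => //= Er;
      rewrite Er in xr.
    case: r2' yr => // a2 r2 yr _; apply/or3P/Or33; rewrite -Er.
    apply/hasP; exists x; first by rewrite mem_cat xr orbT.
    by rewrite xp; apply/hasP; exists y.
  have Bx : all (geq x) B by rewrite -all_predC in xB;
     apply: sub_all xB => y /=; rewrite -leqNgt.
  rewrite row_insert_end ?all_cat ?Ax // rcons_cat.
  have [xC|xC] := boolP (has (ltn x) C).
    move=> eR; case: (nd _ _ eR); rewrite -rcons_cat.
    case: C xC {Cb CB ABC eR} => // c C xC.
    have ->: two_rows (rcons (A ++ B) x) (c :: C) = [:: rcons (A ++ B) x; c :: C].
      by case: (A ++ B).
    apply/or3P/Or33/hasP; exists x; first by rewrite mem_rcons mem_head.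
    by rewrite xp xC.
  have Cx : all (geq x) C by rewrite -all_predC in xC;
     apply: sub_all xC => y /=; rewrite -leqNgt.
  case/IH => //; first by rewrite all_rcons Bb /= xp.
  - rewrite -rcons_cat; case: (C ++ B) CB (all_cat (geq x) C B) => //= c r cr.
    rewrite Cx Bx rcons_path cr => /andP[cx rx].
    by have /= := mem_last c r; rewrite inE => /predU1P[->//|/(allP rx)].
  - by move=> e; have := congr1 size e; rewrite -rcons_cat size_rcons.
  move=> -> -> h1 h2; have := last_step _ h1 h2.
  have -> : (x <= p) = false by rewrite leqNgt xp.
  by rewrite xp cat_rcons size_rcons !addn0 addn1 => /(_ (leqnn _)) [].
have [xA|xA] := boolP (has (ltn x) A).
  have [y + /andP[xy yA]] := row_insert_bump B xA.
  have xr := row_insert_mem x (A ++ B).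
  case: (row_insert x (A ++ B)) xr => r1' b /= xr ->.
  have := row_insert_mem y C; case: (row_insert y C) => r2' [z2|] /= yr eR.
    by case: (nd _ _ eR).
  case: (nd _ _ eR); case: r1' xr eR => // a1 r1' _ _; case: r2' yr => // a2 r2 yr.
  by apply/or3P/Or32/hasP; exists y => //; apply: (allP As).
have Ax : all (geq x) A by rewrite -all_predC in xA;
     apply: sub_all xA => y /=; rewrite -leqNgt.
rewrite row_insert_cat //.
case: B Bb CB ABC last_step => [|y B] /= Bb CB ABC last_step.
  rewrite cats1 => eR; have := IH (rcons A x) [::] C.
  rewrite !cats0 in CB *; rewrite all_rcons As /= xp.
  case=> //; first by move/(congr1 size); rewrite size_rcons.
  move=> -> -> h1 h2; rewrite cat_rcons.
  have h3 : 0 + (p < x) <= size (@nil nat) + (x <= p) by rewrite ltnNge xp.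
  by have [] := last_step [::] h1 h2 h3; rewrite ltnNge xp.
case/andP: Bb => py Bb; have -> /= : x < y by apply: leq_trans py.
have Cy : all (geq y) C.
  move: CB; rewrite sorted_pairwise; last exact: leq_trans.
  rewrite pairwise_cat => /and3P[/allrelP h _ _]; apply/allP => z zC.
  by apply: h; rewrite ?mem_head.
rewrite row_insert_end // -cat_rcons => eR.
have := IH (rcons A x) B (rcons C y); rewrite (cat_rcons y) !all_rcons As Cb /= xp py.
case=> //; first by case: (A).
move=> -> -> h1 h2; rewrite cat_rcons.
have h3 : (size B).+1 + (p < x) <= size B + (x <= p).
  by rewrite ltnNge xp addn0 addn1.
by rewrite cat_rcons; have [] := last_step _ h1 h2 h3; rewrite ltnNge xp.
Qed.

(** The suffix of s that starts at p + 2 contains q - 1 > 1 big entries, hence at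
    least two small ones; these are the last ones, p - 1 and p. *)
Lemma insertion_two_rows_pattern p q s : 1 < p -> 2 < q ->
  foldl tableau_insert [::] s = [:: iota 1 p; iota p.+1 q] ->
  subseq [:: p.+1; p.+2; p.-1; p] s.
Proof.
move=> p1 q2 eP.
have [] := @shuffle_of_insertion p [::] [::] [::] s _ _ isT isT isT isT _ eP.
- by [].
- by apply/allP=> y; rewrite mem_iota /=; lia.
- by apply/allP=> y; rewrite mem_iota /=; lia.
rewrite /= => /esym es /esym eb _ suf.
have ps : p.+2 \in s.
  have : p.+2 \in filter (ltn p) s by rewrite eb mem_iota; lia.
  by rewrite mem_filter => /andP[].
have := cat_take_drop (index p.+2 s) s; rewrite (drop_nth 0) ?index_mem //.
rewrite nth_index //; have := suf (index p.+2 s).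
rewrite (drop_nth 0) ?index_mem // nth_index //.
have : p.+2 \notin take (index p.+2 s) s by rewrite in_take // ltnn.
move: (take _ s) (drop _ s) => s1 s2 ns1 suf2 def_s.
have [F1 F2] : filter (ltn p) s1 = [:: p.+1] /\
    filter (ltn p) s2 = iota p.+3 (q - 2).
  move: eb; rewrite -def_s filter_cat /= leqnSn.
  have : p.+2 \notin filter (ltn p) s1 by rewrite mem_filter negb_and ns1 orbT.
  case: q q2 {eP suf suf2} => [|[|[|q]]] // _.
  case: (filter _ s1) => [|y1 [|y2 r]] //= ny.
  - by case; lia.
  - by case=> -> ->.
  - by case=> _ y2E; move: ny; rewrite y2E !inE eqxx ?orbT.
have cs2 : 1 < count (geq p) s2.
  have : size (filter (ltn p) s2) = q - 2 by rewrite F2 size_iota.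
  by rewrite size_filter => c2; move: suf2; rewrite /= c2; lia.
have sub34 : subseq [:: p.-1; p] s2.
  apply: subseq_trans (filter_subseq (geq p) s2).
  move: es; rewrite -def_s filter_cat /= ifN -?ltnNge ?leqnSn //.
  rewrite -size_filter in cs2; move: cs2.
  move: (filter _ s1) (filter _ s2) => r1 r2 r2s e.
  have -> : r2 = drop (size r1) (iota 1 p) by rewrite -e drop_size_cat.
  rewrite drop_iota; have := congr1 size e; rewrite size_cat size_iota => er.
  have -> : p - size r1 = (size r2 - 2) + 2 by lia.
  rewrite iotaD; have -> : iota (1 + size r1 + (size r2 - 2)) 2 = [:: p.-1; p].
    by rewrite /=; do 2?congr cons; lia.
  by rewrite addnC; apply: suffix_subseq.
rewrite -def_s -cat1s; apply: cat_subseq; last by rewrite /= eqxx.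
by rewrite -F1 filter_subseq.
Qed.

(** * The theorem *)

Lemma one_line_pattern n (w : 'S_n) x1 x2 x3 x4 :
    subseq [:: x1; x2; x3; x4] (one_line w) ->
  exists a b c d : 'I_n, [/\ (a < b)%N, (b < c)%N & (c < d)%N] /\
    [/\ (w a).+1 = x1, (w b).+1 = x2, (w c).+1 = x3 & (w d).+1 = x4].
Proof.
case/subseqP => mk _; rewrite -map_mask.
have : sorted (relpre val ltn) (mask mk (enum 'I_n)).
  apply: (@sorted_mask _ (relpre val ltn)) => [x y z|]; first exact: ltn_trans.
  by rewrite -sorted_map val_enum_ord iota_ltn_sorted.
case: (mask _ _) => [|a [|b [|c [|d [|]]]]] //= /and4P[ab bc cd _] [-> -> -> ->].
by exists a, b, c, d.
Qed.

Lemma right_cell_two_rows (F : closedFieldType) n p q (w : 'S_n) :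
    1 < p -> 2 < q -> w \in right_cell n [:: iota 1 p; iota p.+1 q] ->
  ~ smooth_perm F w /\ subseq [:: p.+1; p.+2; p.-1; p] (one_line w).
Proof.
move=> p1 q2; rewrite inE => /eqP/(insertion_two_rows_pattern p1 q2) pat.
split=> //; have [a [b [c [d [[ab bc cd] [wa wb wc wd]]]]]] := one_line_pattern pat.
(* Entries of the one-line notation are shifted by 1, so m + 1 = p - 1. *)
by apply: (@not_smooth_of_consecutive_3412 F n w a b c d p.-2); lia.
Qed.

Theorem proposition4p1 (F : closedFieldType) (k : nat) (hk : 3 <= k) :
  (forall w : 'S_(2 * k),
     w \in right_cell (2 * k) [:: iota 1 k; iota k.+1 k] ->
     ~ smooth_perm F w /\
     subseq [:: k + 1; k + 2; k - 1; k] (one_line w)) /\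
  (forall w : 'S_(2 * k + 1),
     w \in right_cell (2 * k + 1) [:: iota 1 k.+1; iota k.+2 k] ->
     ~ smooth_perm F w /\
     subseq [:: k + 2; k + 3; k; k + 1] (one_line w)).
Proof.
rewrite addn1 addn2 addn3 subn1.
by split=> w; apply: right_cell_two_rows => //; lia.
Qed.
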